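(* Let $a_1,\dots,a_K\in\mathbb{S}^{D-1}$, $A:=[a_1|\dots|a_K]\in\mathbb{R}^{D\times K}$, let $n\ge2$ be an integer, and suppose $\{a_i^{\otimes n}:i\in[K]\}$ is linearly independent. Let $\mathcal{A}=\operatorname{Span}\{a_i^{\otimes n}:i\in[K]\}$ and $(G_n)_{ij}:=\langle a_i,a_j\rangle^n$. Then for all $x\in\mathbb{S}^{D-1}$, $$F_{\mathcal{A}}(x)=\|P_{\mathcal{A}}(x^{\otimes n})\|_F^2=\big((A^\top x)^{\odot n}\big)^\top G_n^{-1}\big((A^\top x)^{\odot n}\big).$$
   Context: $P_{\mathcal{A}}$ is the orthogonal projector of $(\mathbb{R}^D)^{\otimes n}$ onto $\mathcal{A}$ with respect to the Frobenius inner product; $v^{\odot n}$ is the entrywise $n$-th power of a vector $v$. *)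

(* Defs.v *)
From HB Require Import structures.
From mathcomp Require Import all_boot all_order all_algebra.
From mathcomp Require Import sesquilinear.
From mathcomp Require Import reals.

Set Implicit Arguments.
Unset Strict Implicit.
Unset Printing Implicit Defensive.

Import Order.TTheory GRing.Theory Num.Theory.

Local Open Scope ring_scope.

Definition dotv (R : rcfType) (D : nat) (x y : 'cV[R]_D) : R :=
  (x^T *m y) 0 0.

Definition enorm (R : rcfType) (D : nat) (x : 'cV[R]_D) : R :=
  Num.sqrt (dotv x x).

(* The sphere S^(D-1) of R^D. *)
Definition sphere (R : rcfType) (D : nat) : {pred 'cV[R]_D} :=
  [pred x | enorm x == 1].
Arguments sphere R D : clear implicits.

(* An element of (R^D)^{⊗n} is the family of its entries T_(i_1, ..., i_n).
   The regular module R^o provides the structure of vectType R. *)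
Notation tensor R D n := {ffun n.-tuple 'I_D -> R^o}.

Definition tpow (R : rcfType) (D n : nat) (x : 'cV[R]_D) : tensor R D n :=
  [ffun i => \prod_(k < n) x (tnth i k) 0].
Arguments tpow {R D} n x.

Definition frob (R : rcfType) (D n : nat) (S T : tensor R D n) : R :=
  \sum_i S i * T i.

Section FrobeniusDot.
Variables (R : rcfType) (D n : nat).

Lemma frob_bilinear :
  bilinear_for (GRing.Scale.Law.clone _ _ *%R _)
    (GRing.Scale.Law.clone _ _ (idfun \; *%R) _) (@frob R D n).
Proof.
split=> [T|S] c u v; rewrite /frob /= mulr_sumr -big_split;
  by apply: eq_bigr => i _; rewrite !ffunE /= ?mulrDl ?mulrDr ?mulrA //
    [_ * c]mulrC.
Qed.

HB.instance Definition _ :=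
  bilinear_isBilinear.Build R (tensor R D n) (tensor R D n) R _ _
    (@frob R D n) frob_bilinear.

Lemma frob_sym (S T : tensor R D n) :
  frob S T = (-1) ^+ false * idfun (frob T S).
Proof. by rewrite mul1r; apply: eq_bigr => i _; rewrite mulrC. Qed.

HB.instance Definition _ :=
  isHermitianSesquilinear.Build R (tensor R D n) false idfun
    (@frob R D n) frob_sym.

Lemma frob_gt0 (T : tensor R D n) : T != 0 -> 0 < frob T T.
Proof.
move=> T0; rewrite lt_def; apply/andP; split; last first.
  by apply: sumr_ge0 => i _; rewrite -expr2 sqr_ge0.
apply: contra T0; rewrite psumr_eq0 => [/allP T0|i _]; last first.
  by rewrite -expr2 sqr_ge0.
apply/eqP/ffunP => i; rewrite ffunE; apply/eqP.
by have := T0 i (mem_index_enum i); rewrite /= mulf_eq0 orbb.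
Qed.

HB.instance Definition _ :=
  isDotProduct.Build R (tensor R D n) (@frob R D n) frob_gt0.

End FrobeniusDot.

Definition frobnorm (R : rcfType) (D n : nat) (T : tensor R D n) : R :=
  Num.sqrt (frob T T).

(* The projection onto U along its orthogonal complement for the Frobenius
   inner product; see orthproj_mem and orthproj_ortho. *)
Definition orthproj (R : rcfType) (D n : nat) (U : {vspace tensor R D n}) :
    'End(tensor R D n) :=
  daddv_pi U (orthov (@frob R D n) U).

Section OrthogonalProjector.
Variables (R : rcfType) (D n : nat) (U : {vspace tensor R D n}).
Local Notation Uo := (orthov (@frob R D n) U).

Lemma orthov_cap : (U :&: Uo = 0)%VS.
Proof.
apply/eqP; rewrite -subv0; apply/subvP => T; rewrite memv_cap memv0.
case/andP=> TU /mem_orthovP/(_ _ TU) T0.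
by apply: contraT => /frob_gt0; rewrite T0 ltxx.
Qed.

Lemma orthov_add : (U + Uo)%VS = fullv.
Proof.
apply/eqP; rewrite -dimv_leqif_eq ?subvf // (dimv_disjoint_sum orthov_cap).
rewrite eqn_leq; apply/andP; split.
  by rewrite -(dimv_disjoint_sum orthov_cap) dimvS ?subvf.
pose f (T : tensor R D n) : 'rV[R]_(\dim U) :=
  \row_i frob T (vbasis U)`_i.
have flin : linear f.
  move=> c S T; apply/rowP=> i; rewrite !mxE.
  exact: (frob_bilinear R D n).1.
pose fL := GRing.isLinear.Build R (tensor R D n) 'rV[R]_(\dim U) _ f flin.
pose f' : {linear tensor R D n -> 'rV[R]_(\dim U)} := HB.pack f fL.
rewrite -(limg_ker_dim (linfun f') fullv) capfv addnC leq_add //.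
  by rewrite (leq_trans (dimvS (subvf _))) // dimvf /dim /= mul1n.
apply/dimvS/subvP => T; rewrite memv_ker lfunE /= => /eqP/rowP T0.
by apply/subv_bigcapP => i _; rewrite -memvE memv_ker lfunE /=;
  move: (T0 i); rewrite !mxE => ->.
Qed.

Lemma orthproj_mem T : orthproj U T \in U.
Proof. exact: memv_pi. Qed.

Lemma orthproj_ortho T S : S \in U -> frob (T - orthproj U T) S = 0.
Proof.
move=> SU; have TV : T \in (U + Uo)%VS by rewrite orthov_add memvf.
rewrite -{1}(daddv_pi_add orthov_cap TV) addrAC subrr add0r.
exact: (mem_orthovP (memv_pi _ _ T)).
Qed.

End OrthogonalProjector.

Definition Fobj (R : rcfType) (D n : nat) (U : {vspace tensor R D n})
    (x : 'cV[R]_D) : R :=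
  frobnorm (orthproj U (tpow n x)) ^+ 2.

Definition colsmx (R : rcfType) (D K : nat) (a : 'I_K -> 'cV[R]_D) :
    'M[R]_(D, K) :=
  \matrix_(d, i) a i d 0.

(* As a list, so that [free (tpows n a)] is the linear independence of the
   indexed family: a repeated a_i^{⊗n} makes it false. *)
Definition tpows (R : rcfType) (D K n : nat) (a : 'I_K -> 'cV[R]_D) :
    seq (tensor R D n) :=
  [seq tpow n (a i) | i <- enum 'I_K].
Arguments tpows {R D K} n a.

Definition gram (R : rcfType) (D K n : nat) (a : 'I_K -> 'cV[R]_D) :
    'M[R]_K :=
  \matrix_(i, j) dotv (a i) (a j) ^+ n.
Arguments gram {R D K} n a.

Definition entrypow (R : rcfType) (K n : nat) (v : 'cV[R]_K) : 'cV[R]_K :=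
  map_mx (fun t => t ^+ n) v.
Arguments entrypow {R K} n v.

(* Main.v *)
Require Import Defs.
From mathcomp Require Import all_boot all_order all_algebra.
From mathcomp Require Import reals.

(* The inner products of the a_i^{⊗n} with one another and with x^{⊗n} are
   n-th powers of dot products. Writing P(x^{⊗n}) = ∑_i c_i a_i^{⊗n} and
   w_j = <x, a_j>^n, orthogonality of the residual to each a_j^{⊗n} reads
   c G_n = w^T, and then ‖P(x^{⊗n})‖^2 = ∑_j w_j c_j = w^T G_n^{-1} w. *)

Set Implicit Arguments.
Unset Strict Implicit.
Unset Printing Implicit Defensive.

Import Order.TTheory GRing.Theory Num.Theory.

Local Open Scope ring_scope.

Section Frobenius.
Variables (R : rcfType) (D n : nat).
Implicit Types (x y : 'cV[R]_D) (S T : tensor R D n).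

Lemma frobC S T : frob S T = frob T S.
Proof. by apply: eq_bigr => i _; rewrite mulrC. Qed.

Lemma frobBl S S' T : frob (S - S') T = frob S T - frob S' T.
Proof. by rewrite -sumrB; apply: eq_bigr => i _; rewrite !ffunE mulrBl. Qed.

Lemma frob_suml (I : finType) (c : I -> R) (S : I -> tensor R D n) T :
  frob (\sum_i c i *: S i) T = \sum_i c i * frob (S i) T.
Proof.
under [RHS]eq_bigr do rewrite mulr_sumr.
rewrite exchange_big /=; apply: eq_bigr => t _.
rewrite sum_ffunE mulr_suml; apply: eq_bigr => i _.
by rewrite ffunE mulrA.
Qed.

Lemma frob_eq0 T : frob T T = 0 -> T = 0.
Proof.
move=> T0; apply/eqP; apply: contraT => /frob_gt0.
by rewrite T0 ltxx.
Qed.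

Lemma frobnorm_sqr T : frobnorm T ^+ 2 = frob T T.
Proof.
by rewrite sqr_sqrtr //; apply: sumr_ge0 => i _; rewrite -expr2 sqr_ge0.
Qed.

(** By distributivity, the [n]-th power of a sum over ['I_D] expands into a sum over all index
    tuples of products of entries. *)
Lemma frob_tpow x y : frob (tpow n x) (tpow n y) = dotv x y ^+ n.
Proof.
have -> : dotv x y = \sum_d x d 0 * y d 0.
  by rewrite /dotv mxE; apply: eq_bigr => d _; rewrite mxE.
rewrite -[in RHS](card_ord n) -prodr_const bigA_distr_bigA /=.
(* The expansion is indexed by functions from ['I_n] to ['I_D], the tensor entries by tuples;
   tabulation is the bijection. *)
rewrite /frob (reindex (fun f : {ffun 'I_n -> 'I_D} => [tuple f k | k < n])).
  apply: eq_bigr => f _; rewrite !ffunE -big_split /=.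
  by apply: eq_bigr => k _; rewrite tnth_mktuple.
exists (fun t : n.-tuple 'I_D => [ffun k => tnth t k]) => [f|t] _.
  by apply/ffunP => k; rewrite ffunE tnth_mktuple.
by apply: eq_from_tnth => k; rewrite tnth_mktuple ffunE.
Qed.

End Frobenius.

Section TensorPowers.
Variables (R : rcfType) (D K n : nat) (a : 'I_K -> 'cV[R]_D).

(** The list underlying this tuple is convertible to [tpows n a], so [freeP] and [coord_span] apply
    to it. *)
Local Notation X := [tuple tpow n (a i) | i < K].

Lemma free_tpows_coef0 (c : 'I_K -> R) : free (tpows n a) ->
  \sum_i c i *: tpow n (a i) = 0 -> forall i, c i = 0.
Proof.
move=> /(@freeP _ _ K X) freeX c0; apply: freeX; rewrite -[RHS]c0.
by apply: eq_bigr => i _; rewrite -tnth_nth tnth_mktuple.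
Qed.

Lemma span_tpows_comb (T : tensor R D n) : T \in <<tpows n a>>%VS ->
  exists c : 'I_K -> R, T = \sum_i c i *: tpow n (a i).
Proof.
move=> /(@coord_span _ _ K X) ->; exists (fun i => coord X i T).
by apply: eq_bigr => i _; rewrite -tnth_nth tnth_mktuple.
Qed.

Lemma tpow_in_span i : tpow n (a i) \in <<tpows n a>>%VS.
Proof. by apply/memv_span/map_f; rewrite mem_enum. Qed.

Lemma mulmx_gram (c : 'I_K -> R) j :
  ((\row_i c i) *m gram n a) 0 j
    = frob (\sum_i c i *: tpow n (a i)) (tpow n (a j)).
Proof.
by rewrite frob_suml mxE; apply: eq_bigr => i _; rewrite !mxE frob_tpow.
Qed.

(** A vector [v] in the left kernel of the Gram matrix gives a combination [T] orthogonal to every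
    generator, hence to itself; so [T = 0], and freeness forces [v = 0]. *)
Lemma gram_unitmx : free (tpows n a) -> gram n a \in unitmx.
Proof.
move=> freea; rewrite -row_free_unit; apply: inj_row_free => v vG0.
pose T := \sum_i v 0 i *: tpow n (a i).
have orthT j : frob T (tpow n (a j)) = 0.
  rewrite -mulmx_gram (_ : \row_i v 0 i = v) ?vG0 ?mxE //.
  by apply/rowP => i; rewrite mxE.
have /frob_eq0 T0 : frob T T = 0.
  by rewrite frob_suml big1 // => i _; rewrite frobC orthT mulr0.
by apply/rowP => i; rewrite [RHS]mxE (free_tpows_coef0 freea T0).
Qed.

(** Reads the vector of the closed formula as inner products, to which orthogonality of the residual
    applies. *)
Lemma entrypow_colsmxE (x : 'cV[R]_D) j :
  entrypow n ((colsmx a)^T *m x) j 0 = frob (tpow n x) (tpow n (a j)).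
Proof.
rewrite frobC frob_tpow /dotv !mxE; congr (_ ^+ n).
by apply: eq_bigr => d _; rewrite !mxE.
Qed.

Lemma frobnorm_orthproj_tpow (x : 'cV[R]_D) : free (tpows n a) ->
  frobnorm (orthproj <<tpows n a>>%VS (tpow n x)) ^+ 2
    = ((entrypow n ((colsmx a)^T *m x))^T *m invmx (gram n a)
         *m entrypow n ((colsmx a)^T *m x)) 0 0.
Proof.
move=> freea; set w := entrypow _ _; set P := orthproj _ _.
have [c defP] := span_tpows_comb (orthproj_mem <<tpows n a>>%VS (tpow n x)).
rewrite -/P in defP.
have Pa j : frob P (tpow n (a j)) = w j 0.
  rewrite entrypow_colsmxE; apply/esym/eqP; rewrite -subr_eq0 -frobBl.
  by rewrite orthproj_ortho ?tpow_in_span.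
have cG : (\row_i c i) *m gram n a = w^T.
  by apply/rowP => j; rewrite mulmx_gram -defP Pa [RHS]mxE.
(* With [w^T] replaced by [c G], the inverse cancels. Only one factor of [frob P P] is expanded;
   [Pa] evaluates the other. *)
rewrite -cG mulmxK ?gram_unitmx // frobnorm_sqr {1}defP frob_suml mxE.
by apply: eq_bigr => i _; rewrite mxE frobC Pa.
Qed.

End TensorPowers.

Theorem lemma4 (R : realType) (D K n : nat) (a : 'I_K -> 'cV[R]_D)
    (ha : forall i : 'I_K, a i \in sphere R D)
    (hn : (2 <= n)%N)
    (hfree : free (tpows n a)) :
  gram n a \in unitmx /\
  forall x : 'cV[R]_D, x \in sphere R D ->
    Fobj <<tpows n a>>%VS x
      = frobnorm (orthproj <<tpows n a>>%VS (tpow n x)) ^+ 2 /\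
    frobnorm (orthproj <<tpows n a>>%VS (tpow n x)) ^+ 2
      = ((entrypow n ((colsmx a)^T *m x))^T *m invmx (gram n a)
           *m entrypow n ((colsmx a)^T *m x)) 0 0.
Proof.
(* [invmx] returns a singular matrix unchanged, so this conjunct ensures that the formula involves a
   true inverse. *)
split=> [|x _]; first exact: gram_unitmx.
by split; last exact: frobnorm_orthproj_tpow.
Qed.
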